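(* Let $R\subseteq\mathbb R$ be an archimedean real closed field, let $R(x,y)$ be the rational function field in two variables, and let $\xi$ be an $\mathbb R$-place of $R(x)$ with $\xi|_R=\mathrm{id}_R$; put $\overline F=\xi(R(x))\setminus\{\infty\}$. Let $\xi_y$ be the constant extension of $\xi$ to $R(x)(y)=R(x,y)$ and for $\zeta\in M(R(y))$ let $\zeta_{\overline F}$ be the constant extension of $\zeta$ to $\overline F(y)$. Then the map $\iota:M(R(y))\to M(R(x,y))$, $\iota(\zeta)=\zeta_{\overline F}\circ\xi_y$, is the unique continuous injective map $M(R(y))\to M(R(x,y))$ which is compatible with restriction and such that every place in its image restricts to $\xi$ on $R(x)$.
   Context: For a field $K$, $M(K)$ is the set of $\mathbb R$-places $K\to\mathbb R\cup\{\infty\}$, with topology generated by the subbasis $H'(b)=\{\zeta\in M(K)\mid \infty\ne\zeta(b)>0\}$, $b\in K$. A map $\iota:M(R(y))\to M(R(x,y))$ is compatible with restriction if $\iota(\zeta)|_{R(y)}=\zeta$ for all $\zeta$. The constant (Gauss) extension $\xi_y$ of $\xi$ to $R(x)(y)$ is the place extending $\xi$ whose valuation is the Gauss valuation: on a polynomial $\sum c_iy^i$ with all $c_i$ in the valuation ring of $\xi$ it acts by applying $\xi$ to the coefficients; its residue field is $\overline F(y)$. Every $\zeta\in M(R(y))$ is the identity on $R$; $\zeta_{\overline F}$ is the unique $\mathbb R$-place of $\overline F(y)$ which is the identity on $\overline F$ and satisfies $\zeta_{\overline F}(y)=\zeta(y)$. *)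

(* Defs.v *)
From HB Require Import structures.
From mathcomp Require Import all_boot all_order all_algebra.
From mathcomp Require Import reals.
Set Implicit Arguments. Unset Strict Implicit. Unset Printing Implicit Defensive.
Import Order.TTheory GRing.Theory Num.Theory.
Local Open Scope ring_scope.

Notation "x %:F" := (@FracField.tofrac _ x).

(* Places are modelled as maps K -> option L, [None] standing for infinity. *)

(* [place_on S phi] : phi is a place of the subfield S of K into L, i.e.
   O = {a in S | phi a <> oo} is a valuation ring of S (a in S\{0} not in O
   iff phi(a^-1) = 0) and phi is a ring morphism O -> L. *)
Definition place_on (K L : fieldType) (S : K -> Prop) (phi : K -> option L) : Prop :=
  phi 0 = Some 0 /\ phi 1 = Some 1 /\
  (forall a b u v, S a -> S b -> phi a = Some u -> phi b = Some v ->
     phi (a + b) = Some (u + v) /\ phi (a * b) = Some (u * v)) /\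
  (forall a, S a -> a != 0 -> (phi a = None <-> phi a^-1 = Some 0)).

Definition place (K L : fieldType) (phi : K -> option L) : Prop :=
  place_on (fun _ => True) phi.

Definition Rplace (RR : realType) (K : fieldType) (phi : K -> option RR) : Prop :=
  place phi.

Definition place_comp (K L M : fieldType) (psi : L -> option M) (phi : K -> option L)
  : K -> option M := fun a => match phi a with None => None | Some b => psi b end.

Definition Hsub (RR : realType) (K : fieldType) (b : K) (z : K -> option RR) : Prop :=
  exists r, z b = Some r /\ 0 < r.

Definition Mopen (RR : realType) (K : fieldType) (U : (K -> option RR) -> Prop) : Prop :=
  forall z, Rplace z -> U z ->
    exists bs : seq K, (forall b, b \in bs -> Hsub b z) /\
      (forall z', Rplace z' -> (forall b, b \in bs -> Hsub b z') -> U z').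

Definition Mcontinuous (RR : realType) (K1 K2 : fieldType)
  (f : (K1 -> option RR) -> (K2 -> option RR)) : Prop :=
  forall V, Mopen V -> Mopen (fun z => V (f z)).

Definition RX (R : rcfType) := {fraction {poly R}}.
Definition RXY (R : rcfType) := {fraction {poly RX R}}.
Definition RY (R : rcfType) := {fraction {poly R}}.
Definition RRY (RR : realType) := {fraction {poly RR}}.

Definition cstX (R : rcfType) (c : R) : RX R := (c%:P)%:F.
Definition inX (R : rcfType) (c : RX R) : RXY R := (c%:P)%:F.
Definition liftY (R : rcfType) (p : {poly R}) : {poly RX R} := map_poly (@cstX R) p.

Definition restrY (RR : realType) (R : rcfType) (w : RXY R -> option RR)
  (z : RY R -> option RR) : Prop :=
  forall p q : {poly R}, q != 0 ->
    w ((liftY p)%:F / (liftY q)%:F) = z (p%:F / q%:F).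

Definition restrX (RR : realType) (R : rcfType) (w : RXY R -> option RR)
  (xi : RX R -> option RR) : Prop :=
  forall c : RX R, w (inX c) = xi c.

Definition pval (RR : realType) (R : rcfType) (xi : RX R -> option RR) (c : RX R) : RR :=
  odflt 0 (xi c).

(* Constant (Gauss) extension xi_y of xi to R(x)(y), with values in
   Fbar(y), a subfield of RR(y): a place extending xi acting on polynomials
   with coefficients in the valuation ring of xi by applying xi to the
   coefficients. *)
Definition gauss_ext (RR : realType) (R : rcfType) (xi : RX R -> option RR)
  (xiy : RXY R -> option (RRY RR)) : Prop :=
  place xiy /\
  (forall c : RX R, xiy (inX c) = omap (fun r => (r%:P)%:F) (xi c)) /\
  (forall P : {poly RX R}, (forall i, xi P`_i <> None) ->
     xiy (P%:F) = Some ((map_poly (pval xi) P)%:F)).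

Definition Fbar (RR : realType) (R : rcfType) (xi : RX R -> option RR) : RR -> Prop :=
  fun r => exists c, xi c = Some r.

Definition FbarY (RR : realType) (R : rcfType) (xi : RX R -> option RR) : RRY RR -> Prop :=
  fun g => exists p q : {poly RR}, [/\ q != 0,
               (forall i, Fbar xi p`_i), (forall i, Fbar xi q`_i) &
               g = p%:F / q%:F].

Definition const_ext (RR : realType) (R : rcfType) (xi : RX R -> option RR)
  (z : RY R -> option RR) (psi : RRY RR -> option RR) : Prop :=
  place_on (FbarY xi) psi /\
  (forall r, Fbar xi r -> psi ((r%:P)%:F) = Some r) /\
  psi ('X%:F) = z ('X%:F).

Definition iota_props (RR : realType) (R : rcfType) (xi : RX R -> option RR)
  (i : (RY R -> option RR) -> (RXY R -> option RR)) : Prop :=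
  [/\ (forall z, Rplace z -> Rplace (i z)),
      Mcontinuous i,
      (forall z1 z2, Rplace z1 -> Rplace z2 -> (forall f, i z1 f = i z2 f) ->
                     forall f, z1 f = z2 f),
      (forall z, Rplace z -> restrY (i z) z) &
      (forall z, Rplace z -> restrX (i z) xi)].

(* Main.v *)
Require Import Defs.
From HB Require Import structures.
From mathcomp Require Import all_boot all_order all_algebra.
From mathcomp Require Import reals.
From mathcomp Require Import boolp polyrcf.
Import Order.TTheory GRing.Theory Num.Theory.
Local Open Scope ring_scope.
Set Implicit Arguments. Unset Strict Implicit. Unset Printing Implicit Defensive.

(* A real place of R(y) is the identity on R, because R is archimedean and its
   nonnegative elements are squares; so it is determined by its value at y, as
   is any place of Fbar(y) over Fbar.  Near a given place, in the coordinate y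
   or 1/y, a fraction whose value is positive keeps a positive value: this
   gives the continuity of iota.

   Uniqueness: write f in R(x,y) as c P / Q with c in R(x) and P, Q polynomials
   in y over the valuation ring of xi having a coefficient 1.  If t = zeta(y) is
   finite and not a root of the nonzero reductions p, q of P, Q, then every
   place over xi and zeta takes on f the value xi(c) p(t) / q(t).  Hence two
   sections iota, iota' satisfying the requirements agree on f away from
   finitely many t.  Evaluation places of R(y) with t outside a finite set are
   dense, so by continuity iota and iota' agree on f everywhere. *)

(** * Places and subfields *)

Record subfield_set (K : fieldType) (S : K -> Prop) : Prop := SubfieldSet {
  sf1 : S 1;
  sfN : forall a, S a -> S (- a);
  sfD : forall a b, S a -> S b -> S (a + b);
  sfM : forall a b, S a -> S b -> S (a * b);
  sfV : forall a, S a -> S a^-1 }.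

Section SubfieldSet.
Variables (K : fieldType) (S : K -> Prop).
Hypothesis sfS : subfield_set S.

Lemma sf0 : S 0.
Proof. by rewrite -(subrr 1); apply: (sfD sfS) => //; [|apply: (sfN sfS)]; apply: (sf1 sfS). Qed.

Lemma sf_sum I (r : seq I) (P : pred I) F :
  (forall i, S (F i)) -> S (\sum_(i <- r | P i) F i).
Proof. by move=> SF; apply: big_ind => // [|a b]; [exact: sf0|exact: (sfD sfS)]. Qed.

Lemma sfX a n : S a -> S (a ^+ n).
Proof.
move=> Sa; elim: n => [|n IH]; first by rewrite expr0; apply: (sf1 sfS).
by rewrite exprS; apply: (sfM sfS).
Qed.

Definition poly_in (p : {poly K}) := forall i, S p`_i.

Lemma poly_in0 : poly_in 0.
Proof. by move=> i; rewrite coef0; apply: sf0. Qed.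

Lemma poly_inC c : S c -> poly_in c%:P.
Proof. by move=> Sc i; rewrite coefC; case: ifP => // _; apply: sf0. Qed.

Lemma poly_inX : poly_in 'X.
Proof. by move=> i; rewrite coefX; case: eqP => _ /=; [apply: (sf1 sfS)|apply: sf0]. Qed.

Lemma poly_inN p : poly_in p -> poly_in (- p).
Proof. by move=> Sp i; rewrite coefN; apply: (sfN sfS). Qed.

Lemma poly_inD p q : poly_in p -> poly_in q -> poly_in (p + q).
Proof. by move=> Sp Sq i; rewrite coefD; apply: (sfD sfS). Qed.

Lemma poly_inM p q : poly_in p -> poly_in q -> poly_in (p * q).
Proof.
by move=> Sp Sq i; rewrite coefM; apply: sf_sum => j; apply: (sfM sfS).
Qed.

Lemma poly_inXn n : poly_in 'X^n.
Proof.
by move=> i; rewrite coefXn; case: eqP => _ /=; [apply: (sf1 sfS)|apply: sf0].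
Qed.

End SubfieldSet.

Lemma subfield_setT (K : fieldType) : subfield_set (fun _ : K => True).
Proof. by []. Qed.

Section Place.
Variables (K L : fieldType) (S : K -> Prop) (phi : K -> option L).
Hypotheses (sfS : subfield_set S) (phiP : place_on S phi).

Lemma place0 : phi 0 = Some 0. Proof. by case: phiP. Qed.
Lemma place1 : phi 1 = Some 1. Proof. by case: phiP => _ []. Qed.

Lemma placeD a b u v : S a -> S b -> phi a = Some u -> phi b = Some v ->
  phi (a + b) = Some (u + v).
Proof. by case: phiP => _ [_ [h _]] Sa Sb pa pb; case: (h a b u v). Qed.

Lemma placeM a b u v : S a -> S b -> phi a = Some u -> phi b = Some v ->
  phi (a * b) = Some (u * v).
Proof. by case: phiP => _ [_ [h _]] Sa Sb pa pb; case: (h a b u v). Qed.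

Lemma placeV_None a : S a -> a != 0 -> (phi a = None <-> phi a^-1 = Some 0).
Proof. by case: phiP => _ [_ [_ h]]; apply: h. Qed.

Lemma placeV0 a : S a -> a != 0 -> phi a = Some 0 -> phi a^-1 = None.
Proof.
by move=> Sa a0 pa; apply/placeV_None; rewrite ?invr_eq0 ?invrK //; apply: (sfV sfS).
Qed.

Lemma placeV a u : S a -> phi a = Some u -> u != 0 -> phi a^-1 = Some u^-1.
Proof.
move=> Sa pa u0; have a0 : a != 0.
  by apply: contra_neq u0 => a0; move: pa; rewrite a0 place0 => -[].
case pv: (phi a^-1) => [v|].
  have := placeM Sa (sfV sfS Sa) pa pv.
  by rewrite divff // place1 => -[] uv; rewrite (mulr1_eq (esym uv)).
have: phi a^-1^-1 = Some 0.
  by apply/placeV_None; rewrite ?invr_eq0 //; apply: (sfV sfS).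
by rewrite invrK pa => -[] uE; rewrite uE eqxx in u0.
Qed.

Lemma placeN1 : phi (-1) = Some (-1).
Proof.
have S1 := sf1 sfS; have SN := sfN sfS S1.
case pN: (phi (-1)) => [v|].
  have := placeD S1 SN place1 pN; rewrite subrr place0 => -[] /esym/eqP.
  by rewrite addrC addr_eq0 => /eqP ->.
(* [-1] is its own inverse, so the value infinity would force the value [0] as well. *)
have N0 : (-1 : K) != 0 by rewrite oppr_eq0 oner_eq0.
by move/(placeV_None SN N0): (pN); rewrite invrN1 pN.
Qed.

Lemma placeN a u : S a -> phi a = Some u -> phi (- a) = Some (- u).
Proof.
move=> Sa pa; rewrite -mulN1r -[- u]mulN1r.
by apply: placeM => //; [apply: (sfN sfS); apply: (sf1 sfS) | exact: placeN1].
Qed.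

Lemma placeB a b u v : S a -> S b -> phi a = Some u -> phi b = Some v ->
  phi (a - b) = Some (u - v).
Proof. by move=> Sa Sb pa pb; apply: placeD => //; [apply: (sfN sfS)|apply: placeN]. Qed.

Lemma placeD_None a b v : S a -> S b -> phi a = None -> phi b = Some v ->
  phi (a + b) = None.
Proof.
move=> Sa Sb pa pb; case pab: (phi (a + b)) => [u|//].
have := placeB (sfD sfS Sa Sb) Sb pab pb.
by rewrite addrK pa.
Qed.

Lemma placeM_None a b v : S a -> S b -> phi a = None -> phi b = Some v ->
  v != 0 -> phi (a * b) = None.
Proof.
move=> Sa Sb pa pb v0; case pab: (phi (a * b)) => [u|//].
have b0 : b != 0.
  by apply: contra_neq v0 => b0; move: pb; rewrite b0 place0 => -[].
have := placeM (sfM sfS Sa Sb) (sfV sfS Sb) pab (placeV Sb pb v0).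
by rewrite mulfK // pa.
Qed.

Lemma place_nat n : phi n%:R = Some n%:R.
Proof.
elim: n => [|n IH]; first exact: place0.
have Sn m : S m%:R.
  by elim: m => [|m Sm]; [exact: (sf0 sfS)|rewrite mulrS; apply: (sfD sfS) => //; apply: (sf1 sfS)].
by rewrite !mulrS; apply: placeD => //; [exact: (sf1 sfS)|exact: place1].
Qed.

Lemma place_horner (P : {poly K}) (p : {poly L}) T t : (forall i, S P`_i) -> S T ->
  (forall i, phi P`_i = Some p`_i) -> phi T = Some t ->
  phi P.[T] = Some p.[t].
Proof.
(* Leading coefficients of [P] may have value [0], so [p] can be shorter than [P]; both are expanded
   up to the common bound [n]. *)
move=> SP ST pP pT; set n := maxn (size P) (size p).
rewrite (@horner_coef_wide _ n P) ?(@horner_coef_wide _ n p) ?leq_maxl ?leq_maxr //.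
have SX i : S (T ^+ i) by apply: (sfX sfS).
have pX i : phi (T ^+ i) = Some (t ^+ i).
  elim: i => [|i IH]; first by rewrite !expr0; apply: place1.
  by rewrite !exprS; apply: placeM.
(* Membership in [S] is carried through the induction, because [phi] is known to be additive only on
   [S]. *)
suff [] : S (\sum_(i < n) P`_i * T ^+ i) /\
  phi (\sum_(i < n) P`_i * T ^+ i) = Some (\sum_(i < n) p`_i * t ^+ i) by [].
elim: n => [|n [Sn IH]]; first by rewrite !big_ord0; split; [exact: (sf0 sfS)|exact: place0].
have SPT : S (P`_n * T ^+ n) by exact: (sfM sfS).
rewrite !big_ord_recr /=; split; first exact: (sfD sfS).
by apply: placeD => //; apply: placeM.
Qed.

End Place.

Lemma place_image_subfield (K L : fieldType) (phi : K -> option L) :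
  place phi -> subfield_set (fun r => exists c, phi c = Some r).
Proof.
move=> phiP; have sT := subfield_setT K; split.
- by exists 1; apply: place1 phiP.
- by move=> u [a pa]; exists (- a); apply: (placeN sT phiP).
- by move=> u v [a pa] [b pb]; exists (a + b); apply: (placeD phiP).
- by move=> u v [a pa] [b pb]; exists (a * b); apply: (placeM phiP).
move=> u [a pa]; have [->|u0] := eqVneq u 0.
  by exists 0; rewrite invr0; apply: place0 phiP.
by exists a^-1; apply: (placeV sT phiP).
Qed.

(** * Comparing the values of two places on different fields *)

Section Agreement.
Variables (K1 K2 L : fieldType) (S1 : K1 -> Prop) (S2 : K2 -> Prop).
Variables (phi1 : K1 -> option L) (phi2 : K2 -> option L).
Hypotheses (sf1 : subfield_set S1) (sf2 : subfield_set S2).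
Hypotheses (P1 : place_on S1 phi1) (P2 : place_on S2 phi2).

Lemma place_agreeV a b : S1 a -> S2 b -> a != 0 -> b != 0 ->
  phi1 a = phi2 b -> phi1 a^-1 = phi2 b^-1.
Proof.
move=> Sa Sb a0 b0; case pb: (phi2 b) => [u|] pa.
  have [u0|u0] := eqVneq u 0.
    by rewrite (placeV0 sf1 P1) ?(placeV0 sf2 P2) // -?u0.
  by rewrite (placeV sf1 P1 Sa pa) ?(placeV sf2 P2 Sb pb).
by move/(placeV_None P1 Sa a0): pa ->; move/(placeV_None P2 Sb b0): pb ->.
Qed.

Lemma place_agreeD a b a' b' v : S1 a -> S2 a' -> S1 b -> S2 b' ->
  phi1 a = phi2 a' -> phi1 b = Some v -> phi2 b' = Some v ->
  phi1 (a + b) = phi2 (a' + b').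
Proof.
move=> Sa Sa' Sb Sb' + pb pb'; case pa': (phi2 a') => [u|] pa.
  by rewrite (placeD P1 Sa Sb pa pb) (placeD P2 Sa' Sb' pa' pb').
by rewrite (placeD_None sf1 P1 Sa Sb pa pb) (placeD_None sf2 P2 Sa' Sb' pa' pb').
Qed.

End Agreement.

(** Coefficient reversal implements the change of coordinate from [T] to [T^-1]. The degree bound
    [n] is a parameter so that a numerator and a denominator can be reversed by the same power of
    [T]. *)
Definition revp (K : fieldType) n (p : {poly K}) : {poly K} :=
  \poly_(i < n.+1) p`_(n - i).

Lemma map_revp (K1 K2 : fieldType) (f : {rmorphism K1 -> K2}) n p :
  map_poly f (revp n p) = revp n (map_poly f p).
Proof.
apply/polyP => i; rewrite coef_map [in LHS]coef_poly [RHS]coef_poly coef_map.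
by case: ifP => // _; rewrite raddf0.
Qed.

Lemma horner_revp (K : fieldType) n (p : {poly K}) T : T != 0 ->
  (size p <= n.+1)%N -> p.[T] = T ^+ n * (revp n p).[T^-1].
Proof.
move=> T0 sp; rewrite (horner_coef_wide _ sp) horner_poly mulr_sumr.
rewrite (reindex_inj rev_ord_inj) /=; apply: eq_bigr => i _.
have le_in : (i <= n)%N by rewrite -ltnS.
rewrite subSS mulrCA; congr (_ * _).
have -> : T ^+ n = T ^+ (n - i) * T ^+ i by rewrite -exprD subnK.
by rewrite exprVn mulfK // expf_neq0.
Qed.

Lemma revp_eq0 (K : fieldType) n (p : {poly K}) : (size p <= n.+1)%N ->
  revp n p = 0 -> p = 0.
Proof.
move=> sp p0; apply/polyP => i; rewrite coef0.
have [le_in|lt_ni] := leqP i n; last by rewrite nth_default // (leq_trans sp).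
have := congr1 (fun q : {poly K} => q`_(n - i)) p0.
by rewrite coef0 coef_poly ltnS leq_subr subKn.
Qed.

Lemma poly_in_revp (K : fieldType) (D : K -> Prop) n p : subfield_set D ->
  poly_in D p -> poly_in D (revp n p).
Proof. by move=> sD Dp i; rewrite coef_poly; case: ifP => // _; apply: sf0. Qed.

(** * Places agreeing on constants and a generator *)

(** The common setting for [R(y)] over [R] and for the subfield [Fbar(y)] of [RR(y)] over [Fbar]: a
    place that acts as [e] on the constants [D], with a chosen generator [T] that is transcendental
    over them ([mktr]). [D] and [S] are predicates, since [Fbar] and [Fbar(y)] are only subsets of
    the ambient fields. *)
Record marked (k K L : fieldType) (D : k -> Prop) (S : K -> Prop)
    (j : {rmorphism k -> K}) (e : {rmorphism k -> L})
    (phi : K -> option L) (T : K) : Prop := Marked {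
  mkD : subfield_set D;
  mkS : subfield_set S;
  mkP : place_on S phi;
  mkSc : forall c, D c -> S (j c);
  mkST : S T;
  mkc : forall c, D c -> phi (j c) = Some (e c);
  mktr : forall p, poly_in D p -> (map_poly j p).[T] = 0 -> p = 0 }.

Section Marked.
Variables (k K L : fieldType) (D : k -> Prop) (S : K -> Prop).
Variables (j : {rmorphism k -> K}) (e : {rmorphism k -> L}).
Variables (phi : K -> option L) (T : K).
Hypothesis mk : marked D S j e phi T.

Lemma marked_in p : poly_in D p -> S (map_poly j p).[T].
Proof.
move=> Dp; have [_ sS _ SD ST _ _] := mk; rewrite horner_coef.
apply: (sf_sum sS) => i; apply: (sfM sS); last exact: (sfX sS).
by rewrite coef_map; apply: SD.
Qed.

Lemma marked_horner p t : poly_in D p -> phi T = Some t ->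
  phi (map_poly j p).[T] = Some (map_poly e p).[t].
Proof.
move=> Dp pT; have [_ sS P SD ST pD _] := mk.
by apply: (place_horner sS P) => // i; rewrite !coef_map //=; [apply: SD|apply: pD].
Qed.

Lemma marked_neq0 p : poly_in D p -> p != 0 -> (map_poly j p).[T] != 0.
Proof. by move=> Dp; apply: contra_neq => /(mktr mk Dp). Qed.

Lemma marked_T0 : T != 0.
Proof.
have := marked_neq0 (poly_inX (mkD mk)).
by rewrite map_polyX hornerX polyX_eq0; apply.
Qed.

(** An algebraic relation for [T^-1] turns into one for [T] when its coefficients are reversed. *)
Lemma markedV : marked D S j e phi T^-1.
Proof.
have [sD sS P SD ST pD tr] := mk; split=> //; first exact: (sfV sS).
move=> p Dp p0; have T0 := marked_T0.
have sp : (size (map_poly j p) <= (size p).+1)%N by rewrite size_map_poly.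
have := horner_revp (invr_neq0 T0) sp; rewrite p0 invrK -map_revp => /esym/eqP.
rewrite mulf_eq0 expf_eq0 invr_eq0 (negbTE T0) andbF /= => /eqP.
by move=> /(tr _ (poly_in_revp _ sD Dp)); apply: revp_eq0.
Qed.

Lemma marked_revp n (p q : {poly k}) : (size p <= n.+1)%N -> (size q <= n.+1)%N ->
  (map_poly j p).[T] / (map_poly j q).[T] =
  (map_poly j (revp n p)).[T^-1] / (map_poly j (revp n q)).[T^-1].
Proof.
move=> sp sq; rewrite !(horner_revp (n := n) marked_T0) ?size_map_poly //.
by rewrite -mulf_div divff ?mul1r ?expf_neq0 ?marked_T0 // !map_revp.
Qed.

End Marked.

(** Serves to shrink the constants from [Fbar] to [R], so that a place of [Fbar(y)] can be compared
    with a place of [R(y)]. *)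
Lemma marked_sub (k' k K L : fieldType) (D' : k' -> Prop) (D : k -> Prop)
    (S : K -> Prop) (j : {rmorphism k -> K}) (e : {rmorphism k -> L})
    (i : {rmorphism k' -> k}) (e' : {rmorphism k' -> L})
    (phi : K -> option L) (T : K) : subfield_set D' ->
  (forall c, D' c -> D (i c)) -> (forall c, D' c -> e (i c) = e' c) ->
  marked D S j e phi T -> marked D' S (j \o i) e' phi T.
Proof.
move=> sD' DD ee' [sD sS P SD ST pD tr]; split=> //=.
- by move=> c /DD; apply: SD.
- by move=> c D'c; rewrite -ee' //; apply/pD/DD.
move=> p Dp; rewrite map_poly_comp => /tr p0.
have: map_poly i p = 0 by apply: p0 => m; rewrite coef_map; apply/DD/Dp.
by move/eqP; rewrite map_poly_eq0 => /eqP.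
Qed.

(** The leading terms cancel. The quotient term is an explicit monomial, so that its coefficient
    visibly stays in any subfield containing those of [p] and [q]. *)
Lemma size_sub_lead (k : fieldType) (p q : {poly k}) :
  (size q <= size p)%N -> p != 0 -> q != 0 ->
  (size (p - (lead_coef p / lead_coef q)%:P * 'X^(size p - size q) * q)%R
     < size p)%N.
Proof.
move=> sqp p0 q0; have sp : (0 < size p)%N by rewrite lt0n size_poly_eq0.
have sq : (0 < size q)%N by rewrite lt0n size_poly_eq0.
rewrite -[X in (_ < X)%N](prednK sp) ltnS; apply/leq_sizeP => i le_pi.
rewrite coefB -mulrA coefCM coefXnM.
have [lt_i|le_i] := ltnP i (size p - size q).
  have : (i < (size p).-1)%N.
    apply: leq_trans lt_i _; rewrite -subn1; exact: leq_sub2l.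
  by rewrite ltnNge le_pi.
move: le_pi; rewrite leq_eqVlt => /orP[/eqP <-|lt_pi].
  have -> : ((size p).-1 - (size p - size q) = (size q).-1)%N.
    by rewrite -!subn1 subnAC subKn.
  by rewrite -!lead_coefE divfK ?lead_coef_eq0 // subrr.
rewrite prednK // in lt_pi.
rewrite !nth_default ?mulr0 ?subrr //.
by rewrite leq_subRL // subnK.
Qed.

Section PlaceAgree.
Variables (k K1 K2 L : fieldType) (D : k -> Prop).
Variables (S1 : K1 -> Prop) (S2 : K2 -> Prop).
Variables (j1 : {rmorphism k -> K1}) (j2 : {rmorphism k -> K2}).
Variables (e : {rmorphism k -> L}).
Variables (phi1 : K1 -> option L) (phi2 : K2 -> option L).

(* When [p] and [q] both vanish at [t], one step of the Euclidean algorithm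
   replaces the larger one by a smaller one that still vanishes at [t]; a
   common factor cannot be cancelled instead, as [t] need not lie in [D]. *)
Lemma place_agree_finite T1 T2 t :
  marked D S1 j1 e phi1 T1 -> marked D S2 j2 e phi2 T2 ->
  phi1 T1 = Some t -> phi2 T2 = Some t ->
  forall p q : {poly k}, poly_in D p -> poly_in D q -> q != 0 ->
  phi1 ((map_poly j1 p).[T1] / (map_poly j1 q).[T1]) =
  phi2 ((map_poly j2 p).[T2] / (map_poly j2 q).[T2]).
Proof.
move=> mk1 mk2 pT1 pT2 p q.
have [sD sS1 P1 _ _ _ _] := mk1; have [_ sS2 P2 _ _ _ _] := mk2.
have [n] := ubnP (size p + size q); elim: n p q => // n IH p q lt_n Dp Dq q0.
have [->|p0] := eqVneq p 0.
  by rewrite !rmorph0 !horner0 !mul0r (place0 P1) (place0 P2).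
have Sp1 := marked_in mk1 Dp; have Sq1 := marked_in mk1 Dq.
have Sp2 := marked_in mk2 Dp; have Sq2 := marked_in mk2 Dq.
have pp1 := marked_horner mk1 Dp pT1; have pq1 := marked_horner mk1 Dq pT1.
have pp2 := marked_horner mk2 Dp pT2; have pq2 := marked_horner mk2 Dq pT2.
have p10 := marked_neq0 mk1 Dp p0; have q10 := marked_neq0 mk1 Dq q0.
have p20 := marked_neq0 mk2 Dp p0; have q20 := marked_neq0 mk2 Dq q0.
have swap : phi1 ((map_poly j1 q).[T1] / (map_poly j1 p).[T1]) =
    phi2 ((map_poly j2 q).[T2] / (map_poly j2 p).[T2]) ->
  phi1 ((map_poly j1 p).[T1] / (map_poly j1 q).[T1]) =
    phi2 ((map_poly j2 p).[T2] / (map_poly j2 q).[T2]).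
  move=> E; rewrite -[X in phi1 X]invf_div -[X in phi2 X]invf_div.
  apply: (place_agreeV sS1 sS2 P1 P2) => //; last 2 first.
  - by rewrite mulf_neq0 ?invr_eq0.
  - by rewrite mulf_neq0 ?invr_eq0.
  - by apply: (sfM sS1) => //; apply: (sfV sS1).
  - by apply: (sfM sS2) => //; apply: (sfV sS2).
have direct (u v : {poly k}) : poly_in D u -> poly_in D v ->
    (map_poly e v).[t] != 0 ->
    phi1 ((map_poly j1 u).[T1] / (map_poly j1 v).[T1]) =
    phi2 ((map_poly j2 u).[T2] / (map_poly j2 v).[T2]).
  move=> Du Dv v0.
  have Su1 := marked_in mk1 Du; have Sv1 := marked_in mk1 Dv.
  have Su2 := marked_in mk2 Du; have Sv2 := marked_in mk2 Dv.
  rewrite (placeM P1 Su1 (sfV sS1 Sv1) (marked_horner mk1 Du pT1)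
             (placeV sS1 P1 Sv1 (marked_horner mk1 Dv pT1) v0)).
  by rewrite (placeM P2 Su2 (sfV sS2 Sv2) (marked_horner mk2 Du pT2)
             (placeV sS2 P2 Sv2 (marked_horner mk2 Dv pT2) v0)).
have [qt0|qt0] := eqVneq (map_poly e q).[t] 0; last exact: direct.
have [pt0|pt0] := eqVneq (map_poly e p).[t] 0; last exact/swap/direct.
have step (u v : {poly k}) : poly_in D u -> poly_in D v -> u != 0 -> v != 0 ->
    (size v <= size u)%N -> (size u + size v < n.+1)%N ->
    phi1 ((map_poly j1 u).[T1] / (map_poly j1 v).[T1]) =
    phi2 ((map_poly j2 u).[T2] / (map_poly j2 v).[T2]).
  move=> Du Dv u0 v0 svu lt_uv.
  have := size_sub_lead svu u0 v0; set s := _ * 'X^_; set r := u - s * v => lt_r.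
  have Ds : poly_in D s.
    apply: (poly_inM sD); last exact: (poly_inXn sD).
    by apply: (poly_inC sD); apply: (sfM sD); [exact: Du|exact/(sfV sD)/Dv].
  have Dr : poly_in D r.
    by apply: (poly_inD sD) => //; apply/(poly_inN sD)/(poly_inM sD).
  have E : phi1 ((map_poly j1 r).[T1] / (map_poly j1 v).[T1]) =
      phi2 ((map_poly j2 r).[T2] / (map_poly j2 v).[T2]).
    by apply: IH => //; rewrite -ltnS; apply: leq_trans lt_uv; rewrite ltnS ltn_add2r.
  (* Hence [u / v] is [r / v] plus a term with the same finite value on both sides; agreement on
     [r / v] carries over even when the value is infinite. *)
  have uE : u = r + s * v by rewrite subrK.
  have frac (K : fieldType) (S : K -> Prop) (j : {rmorphism k -> K}) phi T :
      marked D S j e phi T ->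
      (map_poly j u).[T] / (map_poly j v).[T] =
      (map_poly j r).[T] / (map_poly j v).[T] + (map_poly j s).[T].
    move=> mk; rewrite [in LHS]uE rmorphD rmorphM /= hornerD hornerM mulrDl mulfK //.
    exact: (marked_neq0 mk).
  rewrite (frac _ _ _ _ _ mk1) (frac _ _ _ _ _ mk2).
  apply: (place_agreeD sS1 sS2 P1 P2) E (marked_horner mk1 Ds pT1)
    (marked_horner mk2 Ds pT2); try exact: (marked_in mk1); try exact: (marked_in mk2).
  - by apply: (sfM sS1); [exact: (marked_in mk1)|exact/(sfV sS1)/(marked_in mk1)].
  - by apply: (sfM sS2); [exact: (marked_in mk2)|exact/(sfV sS2)/(marked_in mk2)].
have [sqp|spq] := leqP (size q) (size p); first exact: step.
by apply: swap; apply: step => //; [exact: ltnW|rewrite addnC].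
Qed.

Lemma place_agree T1 T2 :
  marked D S1 j1 e phi1 T1 -> marked D S2 j2 e phi2 T2 ->
  phi1 T1 = phi2 T2 ->
  forall p q : {poly k}, poly_in D p -> poly_in D q -> q != 0 ->
  phi1 ((map_poly j1 p).[T1] / (map_poly j1 q).[T1]) =
  phi2 ((map_poly j2 p).[T2] / (map_poly j2 q).[T2]).
Proof.
move=> mk1 mk2; case pT2: (phi2 T2) => [t|] pT1 p q Dp Dq q0.
  exact: place_agree_finite mk1 mk2 pT1 pT2 _ _ Dp Dq q0.
(* Here [T1] and [T2] have value infinity, so their inverses have value [0], and the finite case
   applies to the reversed polynomials. *)
have [sp sq] : (size p <= (size p + size q).+1)%N /\ (size q <= (size p + size q).+1)%N.
  by rewrite !leqW // ?leq_addr ?leq_addl.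
rewrite (marked_revp mk1 sp sq) (marked_revp mk2 sp sq).
apply: (place_agree_finite (markedV mk1) (markedV mk2) (t := 0)).
- by apply/(placeV_None (mkP mk1) (mkST mk1) (marked_T0 mk1)).
- by apply/(placeV_None (mkP mk2) (mkST mk2) (marked_T0 mk2)).
- exact: poly_in_revp (mkD mk1) Dp.
- exact: poly_in_revp (mkD mk1) Dq.
by apply: contra_neq q0; apply: revp_eq0.
Qed.

End PlaceAgree.

(** * Evaluation places of k(X) *)

Lemma frac_repr (A : idomainType) (f : {fraction A}) :
  exists p q : A, q != 0 /\ f = p%:F / q%:F.
Proof.
elim/quotW: f => x; exists (frac x).1, (frac x).2.
have dx := denom_ratioP x; split=> //.
apply: (canRL (mulfK _)); first by rewrite tofrac_eq0.
unlock FracField.tofrac; rewrite -[LHS]FracField.pi_mul.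
apply/eqmodP; rewrite /= FracField.equivfE /FracField.mulf.
by rewrite !numden_Ratio ?mulf_neq0 ?oner_neq0 // !mulr1 mulrC.
Qed.

Lemma frac_coprime (k : fieldType) (f : {fraction {poly k}}) :
  exists p q : {poly k}, [/\ q != 0, coprimep p q & f = p%:F / q%:F].
Proof.
have [p [q [q0 ->]]] := frac_repr f; exists (p %/ gcdp p q), (q %/ gcdp p q).
have g0 : gcdp p q != 0 by rewrite gcdp_eq0 negb_and q0 orbT.
have pE := divpK (dvdp_gcdl p q); have qE := divpK (dvdp_gcdr p q).
split.
- by apply: contra_neq q0 => q0; rewrite -qE q0 mul0r.
- by rewrite coprimep_div_gcd // q0 orbT.
by rewrite -[in LHS]pE -[in X in _ / X = _]qE !rmorphM -mulf_div divff ?mulr1 ?tofrac_eq0.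
Qed.

Definition cst (k : fieldType) : {rmorphism k -> {fraction {poly k}}} :=
  (@FracField.tofrac {poly k} \o polyC).

Lemma horner_cst (k : fieldType) (p : {poly k}) : (map_poly (cst k) p).['X%:F] = p%:F.
Proof.
by rewrite -[in RHS](comp_polyXr p) /comp_poly -horner_map -map_poly_comp.
Qed.

Lemma markX (k L : fieldType) (D : k -> Prop) S (e : {rmorphism k -> L}) phi :
  subfield_set D -> subfield_set S -> place_on S phi ->
  (forall c, D c -> S (cst k c)) -> S 'X%:F ->
  (forall c, D c -> phi (cst k c) = Some (e c)) -> marked D S (cst k) e phi 'X%:F.
Proof.
move=> sD sS P SD SX pD; split=> // p _.
by rewrite horner_cst => /eqP; rewrite tofrac_eq0 => /eqP.
Qed.

Section Evaluation.
Variables (k L : fieldType) (e : {rmorphism k -> L}) (t : L).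

(** The representation need not be in lowest terms, so sums and products are checked on the obvious
    common denominators. [evp] is then evaluation at [t], with value infinity when every
    representation has a denominator vanishing at [t]. *)
Definition has_value f r := exists p q : {poly k},
  [/\ (map_poly e q).[t] != 0, f = p%:F / q%:F
    & r = (map_poly e p).[t] / (map_poly e q).[t]].

Definition evp (f : {fraction {poly k}}) : option L :=
  if pselect (exists r, has_value f r) is left ex then Some (sval (cid ex)) else None.

Lemma evaluated_neq0 (q : {poly k}) : (map_poly e q).[t] != 0 -> q != 0.
Proof. by apply: contra_neq => ->; rewrite rmorph0 horner0. Qed.

Lemma has_value_uniq f r r' : has_value f r -> has_value f r' -> r = r'.
Proof.
move=> [p [q [qt -> ->]]] [p' [q' [q't E ->]]].
apply/eqP; rewrite eqr_div // -!hornerM -!rmorphM /=; apply/eqP.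
congr ((map_poly e _).[t]); apply/eqP; move/eqP: E.
by rewrite eqr_div ?tofrac_eq0 ?evaluated_neq0 // -!tofracM tofrac_eq.
Qed.

Lemma evpP f r : evp f = Some r <-> has_value f r.
Proof.
rewrite /evp; case: pselect => [ex|nex]; last by split=> // h; case: nex; exists r.
have h := svalP (cid ex); split=> [[<-]//|h'].
by congr Some; apply: has_value_uniq h h'.
Qed.

Lemma has_value1 : has_value 1 1.
Proof. by exists 1, 1; rewrite !rmorph1 !hornerC !divr1 oner_neq0. Qed.

Lemma has_valueM f g u v : has_value f u -> has_value g v -> has_value (f * g) (u * v).
Proof.
move=> [p [q [qt -> ->]]] [p' [q' [q't -> ->]]]; exists (p * p'), (q * q').
by rewrite !rmorphM /= !hornerM mulf_neq0 // !mulf_div.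
Qed.

Lemma evp_place : place evp.
Proof.
split; [|split; [|split]].
- apply/evpP; exists 0, 1.
  by rewrite !rmorph1 !rmorph0 mul0r hornerC horner0 mul0r oner_neq0.
- exact/evpP/has_value1.
- move=> a b u v _ _ /evpP av /evpP bv; split; apply/evpP; last exact: has_valueM.
  have [p [q [qt -> ->]]] := av; have [p' [q' [q't -> ->]]] := bv.
  have q0 := evaluated_neq0 qt; have q'0 := evaluated_neq0 q't.
  exists (p * q' + p' * q), (q * q').
  rewrite !rmorphM !rmorphD !rmorphM /= !(hornerM, hornerD) mulf_neq0 //.
  by rewrite !addf_div // tofrac_eq0.
move=> f _ f0; split=> [fN|/evpP fV0].
  (* In lowest terms [p] and [q] do not both vanish at [t], even after applying [e]; so if [q]
     vanishes there, the inverse fraction has value [0]. *)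
  have [p [q [q0 cpq fE]]] := frac_coprime f.
  have qt : (map_poly e q).[t] = 0.
    apply/eqP/negP => /negP qt; suff: evp f <> None by [].
    by rewrite (iffRL (evpP _ _) (ex_intro _ p (ex_intro _ q (And3 qt fE erefl)))).
  apply/evpP; exists q, p; split; last by rewrite qt mul0r.
    have := @coprimep_root _ (map_poly e q) (map_poly e p) t.
    by rewrite coprimep_map coprimep_sym cpq rootE qt eqxx => /(_ isT isT).
  by rewrite fE invf_div.
case E: (evp f) => [s|//]; move/evpP: E => /has_valueM /(_ fV0).
rewrite divff // mulr0 => /(has_value_uniq has_value1)/eqP.
by rewrite oner_eq0.
Qed.

Lemma evp_marked : marked (fun _ => True) (fun _ => True) (cst k) e evp 'X%:F.
Proof.
apply: markX; try exact: subfield_setT; try exact: evp_place; try by [].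
move=> c _; apply/evpP; exists c%:P, 1.
by rewrite !rmorph1 map_polyC !hornerC !divr1 oner_neq0.
Qed.

Lemma evp_X : evp 'X%:F = Some t.
Proof.
apply/evpP; exists 'X, 1.
by rewrite !rmorph1 map_polyX hornerX !hornerC !divr1 oner_neq0.
Qed.

End Evaluation.

(* One of ['X], ['X^-1] has a finite value, so every point of the place space
   of [k(X)] lies in one of the two affine charts of the projective line. *)
Lemma chart (k K L : fieldType) (D : k -> Prop) S (j : {rmorphism k -> K})
    (e : {rmorphism k -> L}) phi T : marked D S j e phi T ->
  exists (b : bool) t, phi (if b then T else T^-1) = Some t.
Proof.
move=> mk; case pT: (phi T) => [t|]; first by exists true, t.
exists false, 0; apply/(placeV_None (mkP mk) (mkST mk)) => //.
exact: marked_T0 mk.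
Qed.

Lemma marked_chart (k K L : fieldType) (D : k -> Prop) S (j : {rmorphism k -> K})
    (e : {rmorphism k -> L}) phi T (b : bool) : marked D S j e phi T ->
  marked D S j e phi (if b then T else T^-1).
Proof. by case: b => // /markedV. Qed.

Lemma chart_repr (k : fieldType) (D : k -> Prop) (p q : {poly k}) (b : bool) :
  subfield_set D -> poly_in D p -> poly_in D q -> q != 0 ->
  exists p' q', [/\ poly_in D p', poly_in D q', q' != 0 &
    p%:F / q%:F = (map_poly (cst k) p').[if b then 'X%:F else 'X%:F^-1]
                / (map_poly (cst k) q').[if b then 'X%:F else 'X%:F^-1]].
Proof.
move=> sD Dp Dq q0; case: b; first by exists p, q; rewrite !horner_cst.
set n := (size p + size q)%N.
have [sp sq] : (size p <= n.+1)%N /\ (size q <= n.+1)%N.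
  by rewrite !leqW // ?leq_addr ?leq_addl.
exists (revp n p), (revp n q); split; try exact: poly_in_revp.
  by apply: contra_neq q0; apply: revp_eq0.
(* Evaluation at [0] supplies a place marked at ['X], as required to cancel the powers of ['X]. *)
by rewrite -(horner_cst p) -(horner_cst q); apply: (marked_revp (evp_marked idfun 0)).
Qed.

(** * Real parameters: stability of positive values, avoidance of finite sets *)

Section Positivity.
Variable RR : realType.

(** The quotient of the values of [p] and [q] has the sign of their product, which is polynomial in
    the parameter. Positivity of the product nearby also keeps the denominator away from [0]. *)
Lemma evp_near (k : fieldType) (e : {rmorphism k -> RR}) f t r :
  evp e t f = Some r -> 0 < r ->
  exists2 d, 0 < d & forall t', `|t' - t| < d ->
    exists2 r', evp e t' f = Some r' & 0 < r'.
Proof.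
move=> /evpP [p [q [qt fE ->]]]; rewrite -(pmulr_lgt0 _ (x := (map_poly e q).[t] ^+ 2)).
  rewrite expr2 mulrA divfK // -hornerM => pq0.
  (* The tolerance is the value of the product at [t] itself, which leaves it positive. *)
  have [d d0 dP] := poly_cont t (map_poly e p * map_poly e q) pq0.
  exists d => // t' /dP; rewrite ltr_distl subrr => /andP[pq'0 _].
  move: pq'0; rewrite hornerM => pq'0.
  have qt' : (map_poly e q).[t'] != 0.
    by apply: contraTneq pq'0 => ->; rewrite mulr0 ltxx.
  exists ((map_poly e p).[t'] / (map_poly e q).[t']).
    by apply/evpP; exists p, q.
  rewrite -(pmulr_lgt0 _ (x := (map_poly e q).[t'] ^+ 2)) ?exprn_even_gt0 //.
  by rewrite expr2 mulrA divfK.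
by rewrite exprn_even_gt0.
Qed.

Lemma avoid_list (t d : RR) (B : seq RR) : 0 < d ->
  exists2 t', `|t' - t| < d & t' \notin t :: B.
Proof.
(* The induction on [B] needs a whole interval to the right of [t] free of [B]; each new element
   only shortens it. *)
move=> d0; suff [c [c0 cd cB]] : exists c, [/\ 0 < c, c < d &
    forall x, 0 < x -> x <= c -> t + x \notin B].
  exists (t + c); first by rewrite addrAC subrr add0r gtr0_norm.
  by rewrite inE negb_or cB // andbT -subr_eq0 addrAC subrr add0r gt_eqF.
elim: B => [|b B [c [c0 cd cB]]].
  by exists (d / 2); rewrite divr_gt0 // ltr_pdivrMr // mulr_natr mulr2n ltrDl.
have [bt|bt] := leP b t.
  exists c; split=> // x x0 xc; rewrite inE negb_or cB // andbT.
  by rewrite gt_eqF // (le_lt_trans bt) // ltrDl.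
exists (Num.min c ((b - t) / 2)).
have bt2 : 0 < (b - t) / 2 by rewrite divr_gt0 // subr_gt0.
split; [by rewrite lt_min c0| by rewrite gt_min cd|] => x x0.
rewrite le_min => /andP[xc xb]; rewrite inE negb_or cB // andbT lt_eqF //.
rewrite addrC -ltrBrDr (le_lt_trans xb) //.
by rewrite ltr_pdivrMr // mulr_natr mulr2n ltrDl subr_gt0.
Qed.

End Positivity.

(** * Real places of R(y) *)

(** By [place_agree], a marked place takes on the fraction the value of the evaluation place at its
    coordinate [T], which reduces the claim to [evp_near]. The radius [d] is uniform in the place
    and in its domain. *)
Lemma marked_near (RR : realType) (k : fieldType) (D : k -> Prop)
    (e : {rmorphism k -> RR}) S phi (b : bool) u (p q : {poly k}) :
  let T : {fraction {poly k}} := if b then 'X%:F else 'X%:F^-1 in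
  marked D S (cst k) e phi 'X%:F -> phi T = Some u ->
  poly_in D p -> poly_in D q -> q != 0 -> Hsub (p%:F / q%:F) phi ->
  exists2 d, 0 < d & forall S' phi' u', marked D S' (cst k) e phi' 'X%:F ->
    phi' T = Some u' -> `|u' - u| < d -> Hsub (p%:F / q%:F) phi'.
Proof.
move=> T mk pT Dp Dq q0 [r [pr r0]].
have [p' [q' [Dp' Dq' q'0 fE]]] := chart_repr b (mkD mk) Dp Dq q0.
have agree S' phi' u' : marked D S' (cst k) e phi' 'X%:F -> phi' T = Some u' ->
    phi' (p%:F / q%:F) = evp e u' (p'%:F / q'%:F).
  move=> /(marked_chart b) mk' pT'; rewrite fE -(horner_cst p') -(horner_cst q').
  have mkE : marked D (fun _ => True) (cst k) e (evp e u') 'X%:F.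
    have [_ sS P _ _ pD _] := evp_marked e u'.
    by apply: markX => //; [exact: mkD mk|move=> c _; exact: pD].
  by apply: (place_agree mk' mkE) => //; rewrite pT' evp_X.
have [d d0 dP] := evp_near (etrans (esym (agree _ _ _ mk pT)) pr) r0.
exists d => // S' phi' u' mk' pT' /dP[r' r'E r'0].
by exists r'; rewrite (agree _ _ _ mk' pT').
Qed.

Section RealPlaces.
Variables (RR : realType) (R : rcfType) (emb : {rmorphism R -> RR}).

Lemma emb_ge0 (c : R) : 0 <= c -> 0 <= emb c.
Proof. by move=> c0; rewrite -(sqr_sqrtr c0) rmorphXn sqr_ge0. Qed.

Lemma Rplace_sqr (K : fieldType) (w : K -> option RR) a u :
  Rplace w -> w (a ^+ 2) = Some u -> 0 <= u.
Proof.
move=> P; have sT := subfield_setT K; case wa: (w a) => [v|].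
  by rewrite expr2 (placeM P _ _ wa wa) // => -[<-]; rewrite -expr2 sqr_ge0.
(* If [a] has value infinity, so has its square: otherwise [1], the product of [a ^+ 2] and
   [a^-1 ^+ 2], would have value [0]. *)
have a0 : a != 0 by apply/eqP => a0; move: wa; rewrite a0 (place0 P).
move/(placeV_None P I a0): wa => wV wa2.
have := placeM P I I wa2 (placeM P I I wV wV).
rewrite -expr2 -exprMn divff // expr1n (place1 P) !mulr0 => -[] /eqP.
by rewrite oner_eq0.
Qed.

Lemma Rplace_ge0 (w : R -> option RR) c u :
  Rplace w -> 0 <= c -> w c = Some u -> 0 <= u.
Proof. by move=> P c0; rewrite -(sqr_sqrtr c0); apply: Rplace_sqr. Qed.

(* [R] is archimedean since it embeds in [RR]: any [c] satisfies [-n <= c <= n],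
   and an infinite value of [c] would give the nonnegative elements
   [n / c - 1] (for [c > 0]) or [- (n / c + 1)] (for [c < 0]) the value [-1]. *)
Lemma Rplace_finite (w : R -> option RR) c : Rplace w -> w c <> None.
Proof.
move=> P wc; have sT := subfield_setT R.
have c0 : c != 0 by apply/eqP => c0; move: wc; rewrite c0 (place0 P).
set n := (Num.truncn `|emb c|).+1.
have : `|emb c| <= n%:R by apply/ltW/truncnS_gt.
rewrite ler_norml => /andP[nc cn].
have emb_le a : 0 <= emb a -> 0 <= a.
  move=> ea; rewrite leNgt; apply/negP => a0.
  have : 0 <= emb (- a) by rewrite emb_ge0 // oppr_ge0 ltW.
  rewrite rmorphN oppr_ge0 => ea'; have /eqP := le_anti (introT andP (conj ea' ea)).
  by rewrite fmorph_eq0 lt_eqF.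
have ncR : 0 <= n%:R - c by apply: emb_le; rewrite rmorphB rmorph_nat subr_ge0.
have ncR' : 0 <= n%:R + c.
  by apply: emb_le; rewrite rmorphD rmorph_nat addrC -[X in _ + X]opprK subr_ge0.
move/(placeV_None P I c0): wc => wV.
have wn : w (n%:R / c) = Some 0.
  by rewrite (placeM P I I (place_nat sT P n) wV) mulr0.
suff [a a0 wa] : exists2 a, 0 <= a & w a = Some (-1).
  by have := Rplace_ge0 P a0 wa; rewrite oppr_ge0 ler10.
have [cp|cn'] := leP 0 c.
  exists ((n%:R - c) / c); first exact: divr_ge0.
  by rewrite mulrBl divff // (placeB sT P I I wn (place1 P)) sub0r.
exists (- ((n%:R + c) / c)).
  by rewrite -mulrN -invrN divr_ge0 // oppr_ge0 ltW.
rewrite mulrDl divff // (placeN sT P I (placeD P I I wn (place1 P))).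
by rewrite add0r.
Qed.

Lemma place_ratr (w : R -> option RR) q : Rplace w -> w (ratr q) = Some (ratr q).
Proof.
move=> P; have sT := subfield_setT R.
have w_int m : w m%:~R = Some m%:~R.
  case: m => n; first exact: (place_nat sT P).
  by rewrite NegzE !mulrNz; apply/(placeN sT P I)/(place_nat sT P).
apply: (placeM P I I (w_int _)); apply: (placeV sT P I (w_int _)).
by rewrite intr_eq0 denq_neq0.
Qed.

(** Both [w] and [emb] fix the rationals and preserve nonnegativity, so a rational strictly between
    the two values of [c] would lie on both sides of [c]. *)
Lemma Rplace_emb (w : R -> option RR) c : Rplace w -> w c = Some (emb c).
Proof.
move=> P; have sT := subfield_setT R.
case wc: (w c) => [u|]; last by have := Rplace_finite P wc.
congr Some; case: (ltgtP u (emb c)) => // /rat_in_itvoo[q]; rewrite in_itv /=.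
  move=> /andP[uq qc]; have wcq := placeB sT P I I wc (place_ratr q P).
  have [cq|cq] := leP 0 (c - ratr q).
    by have := Rplace_ge0 P cq wcq; rewrite subr_ge0 leNgt uq.
  have := @emb_ge0 (- (c - ratr q)); rewrite oppr_ge0 ltW // => /(_ isT).
  by rewrite rmorphN rmorphB fmorph_rat opprB subr_ge0 leNgt qc.
move=> /andP[cq qu]; have wcq := placeB sT P I I (place_ratr q P) wc.
have [qc|qc] := leP 0 (ratr q - c).
  by have := Rplace_ge0 P qc wcq; rewrite subr_ge0 leNgt qu.
have := @emb_ge0 (- (ratr q - c)); rewrite oppr_ge0 ltW // => /(_ isT).
by rewrite rmorphN rmorphB fmorph_rat opprB subr_ge0 leNgt cq.
Qed.

Lemma Rplace_cst (z : RY R -> option RR) c : Rplace z -> z (cst R c) = Some (emb c).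
Proof.
move=> P; apply: (Rplace_emb (w := fun c => z (cst R c))).
have [_ [_ [zDM zV]]] := P.
split; first by rewrite rmorph0 (place0 P).
split; first by rewrite rmorph1 (place1 P).
split=> [a b u v _ _|a _ a0]; first by rewrite rmorphD rmorphM; apply: zDM.
by rewrite fmorphV; apply: zV; rewrite ?fmorph_eq0.
Qed.

Lemma Rplace_marked (z : RY R -> option RR) : Rplace z ->
  marked (fun _ => True) (fun _ => True) (cst R) emb z 'X%:F.
Proof.
move=> P; apply: markX => //; try exact: subfield_setT.
by move=> c _; apply: Rplace_cst.
Qed.

Lemma Hsub_seq_near (z0 : RY R -> option RR) (bs : seq (RY R)) (b : bool) u :
  let T : RY R := if b then 'X%:F else 'X%:F^-1 in
  Rplace z0 -> z0 T = Some u -> (forall f, f \in bs -> Hsub f z0) ->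
  exists2 d, 0 < d & forall z u', Rplace z -> z T = Some u' -> `|u' - u| < d ->
    forall f, f \in bs -> Hsub f z.
Proof.
move=> T P zT; elim: bs => [|f bs IH] H; first by exists 1.
have [g gbs|d d0 dP] := IH; first by apply: H; rewrite inE gbs orbT.
have [p [q [q0 fE]]] := frac_repr f.
have := H f (mem_head _ _); rewrite fE => Hf.
have Tin (r : {poly R}) : poly_in (fun _ => True) r by [].
have [d' d'0 d'P] := marked_near (Rplace_marked P) zT (Tin p) (Tin q) q0 Hf.
exists (Num.min d d'); first by rewrite lt_min d0.
move=> z u' Pz zT'; rewrite lt_min => /andP[ud ud'] g.
rewrite inE => /predU1P[->|]; last exact: dP Pz zT' ud g.
by apply: d'P (Rplace_marked Pz) zT' ud'.
Qed.

Lemma Rplace_dense (z0 : RY R -> option RR) (bs : seq (RY R)) (B : seq RR) :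
  Rplace z0 -> (forall f, f \in bs -> Hsub f z0) ->
  exists z t, [/\ Rplace z, z 'X%:F = Some t, t \notin B
    & forall f, f \in bs -> Hsub f z].
Proof.
move=> P H; have [b [u zT]] := chart (Rplace_marked P).
have [d d0 dP] := Hsub_seq_near P zT H.
(* In the chart ['X] the new place is evaluation at [u'], in the chart ['X^-1] it is evaluation at
   [u'^-1]; hence [0], [B] and the inverses of [B] are all avoided. *)
have [u' ud] := avoid_list u (0 :: B ++ map GRing.inv B) d0.
rewrite !inE mem_cat !negb_or => /and4P[_ u'0 uB uB'].
have PE t : Rplace (evp emb t) by exact: evp_place.
case: b zT dP => zT dP.
  exists (evp emb u'), u'; split=> //; first exact: evp_X.
  by apply: dP ud => //; apply: evp_X.
exists (evp emb u'^-1), u'^-1; split=> //; first exact: evp_X.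
  by apply: contra uB' => /(map_f GRing.inv); rewrite invrK.
apply: dP ud => //; rewrite -[u' in RHS]invrK.
by apply: (placeV (subfield_setT _) (PE _) I (evp_X _ _)); rewrite invr_eq0.
Qed.

End RealPlaces.

(** Subbasic sets suffice: the finitely many lists of conditions they yield are concatenated. *)
Lemma Mcontinuous_Hsub (RR : realType) (K1 K2 : fieldType)
    (i : (K1 -> option RR) -> (K2 -> option RR)) :
  (forall z, Rplace z -> Rplace (i z)) ->
  (forall f z, Rplace z -> Hsub f (i z) -> exists bs : seq K1,
    (forall b, b \in bs -> Hsub b z) /\
    (forall z', Rplace z' -> (forall b, b \in bs -> Hsub b z') -> Hsub f (i z'))) ->
  Mcontinuous i.
Proof.
move=> iP iH V oV z Pz Vz; have [fs [fz fV]] := oV _ (iP z Pz) Vz.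
suff [bs [bz bP]] : exists bs : seq K1, (forall b, b \in bs -> Hsub b z) /\
    (forall z', Rplace z' -> (forall b, b \in bs -> Hsub b z') ->
      forall f, f \in fs -> Hsub f (i z')).
  by exists bs; split=> // z' Pz' /(bP _ Pz'); apply: fV; apply: iP.
elim: fs fz {fV} => [|f fs IH] fz; first by exists [::].
have [g gfs|bs [bz bP]] := IH; first by apply: fz; rewrite inE gfs orbT.
have [bs' [bz' bP']] := iH f z Pz (fz f (mem_head _ _)).
exists (bs ++ bs'); split=> [b|z' Pz' H g].
  by rewrite mem_cat => /orP[/bz|/bz'].
rewrite inE => /predU1P[->|gfs].
  by apply: bP' => // b bb; apply: H; rewrite mem_cat bb orbT.
by apply: bP => // b bb; apply: H; rewrite mem_cat bb.
Qed.

Lemma Mcontinuous_Hsub_open (RR : realType) (K1 K2 : fieldType)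
    (i : (K1 -> option RR) -> (K2 -> option RR)) f :
  Mcontinuous i -> Mopen (fun z => Hsub f (i z)).
Proof.
move=> ci; apply: (ci (Hsub f)) => z Pz Hz.
exists [:: f]; split=> [b|z' _]; first by rewrite inE => /eqP ->.
by apply; rewrite inE.
Qed.

Lemma divf_neq0 (K : fieldType) (a b : K) : a != 0 -> b != 0 -> a / b != 0.
Proof. by move=> a0 b0; rewrite mulf_neq0 ?invr_eq0. Qed.

Lemma frac_neq0 (A : idomainType) (p q : A) : p != 0 -> q != 0 -> p%:F / q%:F != 0.
Proof. by move=> p0 q0; rewrite divf_neq0 ?tofrac_eq0. Qed.

Lemma frac_scale (k : fieldType) (c d : k) (P Q : {poly k}) :
  (c *: P)%:F / (d *: Q)%:F = cst k (c / d) * (P%:F / Q%:F).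
Proof. by rewrite -!mul_polyC !tofracM fmorph_div mulf_div. Qed.

(** This is an element of least valuation. Divisibility in a valuation ring is total: when [a / c]
    has value infinity, [c / a] has value [0], and [a] takes over from [c]. *)
Lemma dominant_element (K L : fieldType) (phi : K -> option L) (s : seq K) :
  place phi -> has (fun a => a != 0) s ->
  exists c, [/\ c \in s, c != 0 & forall a, a \in s -> phi (a / c) <> None].
Proof.
move=> P.
have xi1 a : a != 0 -> phi (a / a) <> None by move=> a0; rewrite divff // (place1 P).
have xi0 a : phi (0 / a) <> None by rewrite mul0r (place0 P).
elim: s => //= a s IH; have [/IH [c [cs c0 cP]] _|ns] := boolP (has _ s); last first.
  rewrite orbF => a0; exists a; rewrite mem_head; split=> // b.
  rewrite inE => /predU1P[->|bs]; first exact: xi1.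
  by move/hasPn: ns => /(_ _ bs) /negPn/eqP ->.
case ac: (phi (a / c)) => [v|].
  exists c; rewrite inE cs orbT; split=> // b.
  by rewrite inE => /predU1P[->|/cP//]; rewrite ac.
have a0 : a != 0 by apply/eqP => a0; have := xi0 c; rewrite -a0 ac.
have ac0 : a / c != 0 by exact: divf_neq0.
exists a; rewrite mem_head; split=> // b; rewrite inE => /predU1P[->|bs]; first exact: xi1.
move/(placeV_None P I ac0): ac; rewrite invf_div => ca.
have -> : b / a = b / c * (c / a) by rewrite mulrA divfK.
case bc: (phi (b / c)) (cP _ bs) => [u|//] _.
by rewrite (placeM P I I bc ca).
Qed.

(** * Gauss extension *)

Section Gauss.
Variables (K : fieldType) (RR : realType) (xi : K -> option RR).
Hypothesis xi_place : Rplace xi.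

(** The residue map of the valuation ring of [xi]; the default [0] stands for an infinite value,
    which [finite_coefs] excludes. *)
Definition reduction (c : K) : RR := odflt 0 (xi c).

Definition finite_coefs (P : {poly K}) := forall i, xi P`_i <> None.

Lemma reductionE c : xi c <> None -> xi c = Some (reduction c).
Proof. by rewrite /reduction; case: (xi c). Qed.

Lemma reduction0 : reduction 0 = 0.
Proof. by rewrite /reduction (place0 xi_place). Qed.

(** Division by a dominant coefficient makes all coefficients finite and turns that one into [1],
    which survives reduction. *)
Lemma primitive_form (P : {poly K}) : P != 0 -> exists c P',
  [/\ c != 0, P = c *: P', finite_coefs P' & map_poly (reduction) P' != 0].
Proof.
move=> P0; have [|c [cP c0 cmax]] := @dominant_element _ _ _ P xi_place.
  apply/hasP; exists (lead_coef P); last by rewrite lead_coef_eq0.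
  by rewrite lead_coefE mem_nth // prednK // lt0n size_poly_eq0.
exists c, (c^-1 *: P); split=> //.
- by rewrite scalerA divff // scale1r.
- move=> i; rewrite coefZ mulrC; have [lt_i|le_i] := ltnP i (size P).
    exact/cmax/mem_nth.
  by rewrite nth_default // mul0r (place0 xi_place).
apply/eqP => /(congr1 (fun p : {poly RR} => p`_(index c P))).
rewrite coef_map_id0 ?reduction0 // coefZ nth_index // mulVf // coef0.
by rewrite /reduction (place1 xi_place) => /eqP; rewrite oner_eq0.
Qed.

Lemma gauss_form (f : {fraction {poly K}}) : f != 0 -> exists c P Q, [/\ c != 0,
  f = cst K c * (P%:F / Q%:F), finite_coefs P, finite_coefs Q &
  map_poly (reduction) P != 0 /\ map_poly (reduction) Q != 0].
Proof.
have [P [Q [Q0 ->]]] := frac_repr f; rewrite mulf_eq0 negb_or tofrac_eq0 => /andP[P0 _].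
have [c [P' [c0 -> P'f P'0]]] := primitive_form P0.
have [d [Q' [d0 -> Q'f Q'0]]] := primitive_form Q0.
exists (c / d), P', Q'; split=> //; first exact: divf_neq0.
exact: frac_scale.
Qed.

Lemma value_of_primitive (w : {fraction {poly K}} -> option RR) P t : Rplace w ->
  (forall c, w (cst K c) = xi c) -> w 'X%:F = Some t -> finite_coefs P ->
  w P%:F = Some (map_poly (reduction) P).[t].
Proof.
move=> wP wX wt fP; rewrite -(horner_cst P).
apply: (place_horner (subfield_setT _) wP) => // i.
rewrite coef_map_id0 ?raddf0 // coef_map_id0 ?reduction0 //.
by rewrite -(reductionE (fP i)); apply: wX.
Qed.

Lemma value_generic (f : {fraction {poly K}}) : exists B : seq RR, forall w1 w2 t,
  Rplace w1 -> Rplace w2 -> (forall c, w1 (cst K c) = xi c) -> (forall c, w2 (cst K c) = xi c) ->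
  w1 'X%:F = Some t -> w2 'X%:F = Some t -> t \notin B -> w1 f = w2 f.
Proof.
have [->|/gauss_form[c [P [Q [c0 -> Pf Qf [P0 Q0]]]]]] := eqVneq f 0.
  by exists [::] => w1 w2 t P1 P2 *; rewrite (place0 P1) (place0 P2).
set p := map_poly _ P in P0; set q := map_poly _ Q in Q0.
(* Roots of the numerator [p] are excluded too: when [xi c] is infinite, the product is known to be
   infinite only if the other factor has nonzero value. *)
exists (rootsR (p * q)) => w1 w2 t P1 P2 X1 X2 t1 t2.
rewrite -roots_on_rootsR ?mulf_neq0 // in_itv /= rootM negb_or => /andP[pt qt].
have val w : Rplace w -> (forall c, w (cst K c) = xi c) -> w 'X%:F = Some t ->
    w (P%:F / Q%:F) = Some (p.[t] / q.[t]).
  move=> Pw Xw tw; apply: (placeM Pw I I (value_of_primitive Pw Xw tw Pf)).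
  exact: (placeV (subfield_setT _) Pw I (value_of_primitive Pw Xw tw Qf)).
have pq0 : p.[t] / q.[t] != 0 by exact: divf_neq0.
have v1 := val _ P1 X1 t1; have v2 := val _ P2 X2 t2.
case xc: (xi c) => [r|].
  rewrite (placeM P1 I I (etrans (X1 c) xc) v1).
  by rewrite (placeM P2 I I (etrans (X2 c) xc) v2).
have sXY := subfield_setT ({fraction {poly K}}).
rewrite (placeM_None sXY P1 I I (etrans (X1 c) xc) v1 pq0).
by rewrite (placeM_None sXY P2 I I (etrans (X2 c) xc) v2 pq0).
Qed.

End Gauss.

(** * Uniqueness and existence of iota *)

Section Uniqueness.
Variables (RR : realType) (R : rcfType) (emb : {rmorphism R -> RR}).
Variables (xi : RX R -> option RR).
Hypothesis xi_place : Rplace xi.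
Hypothesis xi_id : forall c : R, xi (cstX c) = Some (emb c).

Lemma iota_X i z : iota_props xi i -> Rplace z -> i z 'X%:F = z 'X%:F.
Proof.
move=> [_ _ _ iY _] Pz; have := iY z Pz 'X 1 (oner_neq0 _).
by rewrite /liftY (map_polyX (cst R)) (rmorph1 (map_poly (cst R))) tofrac1 !divr1.
Qed.

Lemma iota_emb i z c : iota_props xi i -> Rplace z ->
  i z (inX (cstX c)) = Some (emb c).
Proof. by move=> [_ _ _ _ iX] Pz; rewrite iX. Qed.

(** If [a < b], a rational [q] separates them. The conditions that [i1] sends [f] below [q] and [i2]
    sends it above [q] are open by continuity, so both hold at some place near [z] with generic
    value of [y], where [value_generic] makes the two values of [f] equal. *)
Lemma iota_le i1 i2 z f a b : iota_props xi i1 -> iota_props xi i2 -> Rplace z ->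
  i1 z f = Some a -> i2 z f = Some b -> b <= a.
Proof.
move=> H1 H2 Pz fa fb; rewrite leNgt; apply/negP => ab.
have [iP1 ic1 _ _ iX1] := H1; have [iP2 ic2 _ _ iX2] := H2.
have sT := subfield_setT (RXY R).
have /rat_in_itvoo[q] := ab; rewrite in_itv /= => /andP[aq qb].
set m := inX (cstX (ratr q : R)).
have iq i z' : iota_props xi i -> Rplace z' -> i z' m = Some (ratr q).
  by move=> Hi Pz'; rewrite /m (iota_emb _ Hi Pz') fmorph_rat.
have h1 : Hsub (m - f) (i1 z).
  by exists (ratr q - a); rewrite (placeB sT (iP1 z Pz) I I (iq _ _ H1 Pz) fa) subr_gt0.
have h2 : Hsub (f - m) (i2 z).
  by exists (b - ratr q); rewrite (placeB sT (iP2 z Pz) I I fb (iq _ _ H2 Pz)) subr_gt0.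
have [bs1 [z1 U1]] := Mcontinuous_Hsub_open ic1 Pz h1.
have [bs2 [z2 U2]] := Mcontinuous_Hsub_open ic2 Pz h2.
have [B BP] := value_generic xi_place f.
have [g|z' [t [Pz' z't tB H]]] := @Rplace_dense _ _ emb z (bs1 ++ bs2) B Pz.
  by rewrite mem_cat => /orP[/z1|/z2].
have [r1 [r1E r10]] : Hsub (m - f) (i1 z').
  by apply: U1 => // g gb; apply: H; rewrite mem_cat gb.
have [r2 [r2E r20]] : Hsub (f - m) (i2 z').
  by apply: U2 => // g gb; apply: H; rewrite mem_cat gb orbT.
have fE : i1 z' f = i2 z' f.
  apply: (BP _ _ t) => //; [exact: iP1|exact: iP2|exact: iX1|exact: iX2|..];
  by rewrite (iota_X _ Pz').
have f1 : i1 z' f = Some (ratr q - r1).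
  have := placeB sT (iP1 _ Pz') I I (iq _ _ H1 Pz') r1E.
  by rewrite opprB addrC subrK.
have f2 : i2 z' f = Some (r2 + ratr q).
  by have := placeD (iP2 _ Pz') I I r2E (iq _ _ H2 Pz'); rewrite subrK.
move: fE; rewrite f1 f2 => -[] /eqP; rewrite addrC (inj_eq (addIr _)) => /eqP r12.
by move: r20; rewrite -r12 oppr_gt0 => /(lt_trans r10); rewrite ltxx.
Qed.

Lemma iota_finite i1 i2 z f a b : iota_props xi i1 -> iota_props xi i2 -> Rplace z ->
  i1 z f = Some a -> i2 z f = Some b -> a = b.
Proof.
move=> H1 H2 Pz fa fb; apply: le_anti.
by rewrite (iota_le H1 H2 Pz fa fb) (iota_le H2 H1 Pz fb fa).
Qed.

(* A value [oo] is brought to [0] by passing to [1 / (f - n)]. *)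
Lemma iota_infinite i1 i2 z f : iota_props xi i1 -> iota_props xi i2 -> Rplace z ->
  i1 z f = None -> i2 z f = None.
Proof.
move=> H1 H2 Pz f1; case f2: (i2 z f) => [b|//].
have [iP1 _ _ _ _] := H1; have [iP2 _ _ _ _] := H2.
have P1 := iP1 z Pz; have P2 := iP2 z Pz; have sT := subfield_setT (RXY R).
(* [n] exceeds [b], so [f - n] has a nonzero finite value under [i2 z] and its inverse does not have
   value [0]. *)
set n : nat := (Num.truncn b).+1.
have g1 : i1 z (f - n%:R) = None.
  exact: (placeD_None sT P1 I I f1 (placeN sT P1 I (place_nat sT P1 n))).
have g2 := placeB sT P2 I I f2 (place_nat sT P2 n).
have g0 : f - n%:R != 0 by apply/eqP => g0; move: g1; rewrite g0 (place0 P1).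
have b0 : b - n%:R != 0 by rewrite subr_eq0 lt_eqF // truncnS_gt.
move/(placeV_None P1 I g0): g1 => g1.
have := iota_finite H1 H2 Pz g1 (placeV sT P2 I g2 b0).
by move/esym/eqP; rewrite invr_eq0 (negbTE b0).
Qed.

Lemma iota_unique i1 i2 z f : iota_props xi i1 -> iota_props xi i2 -> Rplace z ->
  i1 z f = i2 z f.
Proof.
move=> H1 H2 Pz; case f1: (i1 z f) => [a|]; case f2: (i2 z f) => [b|] //.
- by rewrite (iota_finite H1 H2 Pz f1 f2).
- by rewrite (iota_infinite H2 H1 Pz f2) in f1.
by rewrite (iota_infinite H1 H2 Pz f1) in f2.
Qed.

End Uniqueness.

(** * The composite of the two constant extensions has the required properties *)

Section Existence.
Variables (RR : realType) (R : rcfType) (emb : {rmorphism R -> RR}).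
Variable xi : RX R -> option RR.
Hypothesis xi_place : Rplace xi.
Hypothesis xi_id : forall c : R, xi (cstX c) = Some (emb c).
Variable xiy : RXY R -> option (RRY RR).
Hypothesis xiy_gauss : gauss_ext xi xiy.
Variable zF : (RY R -> option RR) -> (RRY RR -> option RR).
Hypothesis zF_ext : forall z, Rplace z -> const_ext xi z (zF z).

Let iota z := place_comp (zF z) xiy.

Lemma Fbar_subfield : subfield_set (Fbar xi).
Proof. exact: place_image_subfield. Qed.

Lemma FbarY_frac (p q : {poly RR}) : poly_in (Fbar xi) p -> poly_in (Fbar xi) q ->
  q != 0 -> FbarY xi (p%:F / q%:F).
Proof. by move=> Dp Dq q0; exists p, q. Qed.

Lemma FbarY_poly (p : {poly RR}) : poly_in (Fbar xi) p -> FbarY xi p%:F.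
Proof.
move=> Dp; rewrite -[p%:F]divr1 -tofrac1; apply: FbarY_frac => //.
  exact: (poly_inC Fbar_subfield (sf1 Fbar_subfield)).
exact: oner_neq0.
Qed.

Lemma FbarY_subfield : subfield_set (FbarY xi).
Proof.
have sF := Fbar_subfield; split.
- by rewrite -tofrac1; apply/FbarY_poly/(poly_inC sF)/(sf1 sF).
- move=> a [p [q [q0 Dp Dq ->]]]; rewrite -mulNr -tofracN.
  by apply: FbarY_frac => //; apply: (poly_inN sF).
- move=> a b [p [q [q0 Dp Dq ->]]] [p' [q' [q'0 Dp' Dq' ->]]].
  rewrite addf_div ?tofrac_eq0 // -!tofracM -tofracD.
  apply: FbarY_frac; last by rewrite mulf_neq0.
    by apply: (poly_inD sF); apply: (poly_inM sF).
  exact: (poly_inM sF).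
- move=> a b [p [q [q0 Dp Dq ->]]] [p' [q' [q'0 Dp' Dq' ->]]].
  rewrite mulf_div -!tofracM.
  by apply: FbarY_frac; rewrite ?mulf_neq0 //; apply: (poly_inM sF).
move=> a [p [q [q0 Dp Dq ->]]]; rewrite invf_div; have [->|p0] := eqVneq p 0.
  by rewrite tofrac0 invr0 mulr0 -tofrac0; apply/FbarY_poly/(poly_in0 sF).
exact: FbarY_frac.
Qed.

Lemma zF_marked z : Rplace z ->
  marked (Fbar xi) (FbarY xi) (cst RR) idfun (zF z) 'X%:F.
Proof.
move=> Pz; have [P [Pc _]] := zF_ext Pz; have sF := Fbar_subfield.
apply: markX => //; first exact: FbarY_subfield.
  by move=> c Fc; apply/FbarY_poly/(poly_inC sF).
exact/FbarY_poly/(poly_inX sF).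
Qed.

Lemma zF_chart z (b : bool) : Rplace z ->
  zF z (if b then 'X%:F else 'X%:F^-1) = z (if b then 'X%:F else 'X%:F^-1).
Proof.
move=> Pz; have [P [_ zX]] := zF_ext Pz; case: b => //.
apply: (place_agreeV FbarY_subfield (subfield_setT _) P Pz) => //.
- exact: mkST (zF_marked Pz).
- by rewrite tofrac_eq0 polyX_eq0.
by rewrite tofrac_eq0 polyX_eq0.
Qed.

Lemma map_pval_in (P : {poly RX R}) :
  finite_coefs xi P -> poly_in (Fbar xi) (map_poly (reduction xi) P).
Proof.
move=> Pf i; rewrite coef_map_id0 ?reduction0 //.
by exists P`_i; apply: reductionE.
Qed.

(** Makes the composition legitimate, as [zF z] is a place only on [Fbar(y)]. In the Gauss form of
    [f] the primitive part reduces to a nonzero fraction over [Fbar], so a finite value forces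
    [xi c] to be finite. *)
Lemma xiy_in f g : xiy f = Some g -> FbarY xi g.
Proof.
have [Px [xiyX xiyP]] := xiy_gauss; have sT := subfield_setT (RXY R).
have sF := Fbar_subfield.
have [->|/(gauss_form xi_place)[c [P [Q [c0 -> Pf Qf [P0 Q0]]]]]] := eqVneq f 0.
  by rewrite (place0 Px) => -[<-]; apply: (sf0 FbarY_subfield).
have q0 : (map_poly (reduction xi) Q)%:F != 0 by rewrite tofrac_eq0.
have PQ := placeM Px I I (xiyP _ Pf) (placeV sT Px I (xiyP _ Qf) q0).
have Sp := map_pval_in Pf; have Sq := map_pval_in Qf.
have := xiyX c; case xc: (xi c) => [r|] /= xiyc.
  rewrite (placeM Px I I xiyc PQ) => -[<-]; apply: (sfM FbarY_subfield).
    by apply/FbarY_poly/(poly_inC sF); exists c.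
  exact: FbarY_frac.
by rewrite (placeM_None sT Px I I xiyc PQ (frac_neq0 P0 Q0)).
Qed.

Lemma iota_place z : Rplace z -> Rplace (iota z).
Proof.
move=> Pz; have [Px _] := xiy_gauss; have [P _] := zF_ext Pz.
have sT := subfield_setT (RXY R); have sFY := FbarY_subfield.
split; first by rewrite /iota /place_comp (place0 Px) (place0 P).
split; first by rewrite /iota /place_comp (place1 Px) (place1 P).
split=> [a b u v _ _|a _ a0]; rewrite /iota /place_comp.
  case xa: (xiy a) => [a'|//]; case xb: (xiy b) => [b'|//] pa pb.
  rewrite (placeD Px I I xa xb) (placeM Px I I xa xb).
  have Sa := xiy_in xa; have Sb := xiy_in xb.
  by rewrite (placeD P Sa Sb pa pb) (placeM P Sa Sb pa pb).
case xa: (xiy a) => [a'|]; last first.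
  by move/(placeV_None Px I a0): xa ->; rewrite (place0 P).
have [a'0|a'0] := eqVneq a' 0.
  rewrite a'0 in xa *; rewrite (placeV0 sT Px I a0 xa) (place0 P).
  by split.
rewrite (placeV sT Px I xa a'0).
exact: (placeV_None P (xiy_in xa) a'0).
Qed.

Lemma iota_continuous : Mcontinuous iota.
Proof.
apply: Mcontinuous_Hsub iota_place _ => f z Pz [r []]; rewrite /iota /place_comp.
case xf: (xiy f) => [g|//] gr r0; have [p [q [q0 Dp Dq gE]]] := xiy_in xf.
have [b [u uE]] := chart (zF_marked Pz).
have [|d d0 dP] := marked_near (zF_marked Pz) uE Dp Dq q0; first by exists r; rewrite -gE.
(* Closeness to [u] has to be expressed by elements of [R(y)]: rational bounds
   [u - d < a < u < c < u + d] are constants of [R] whose values are known at every real place. *)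
have /rat_in_itvoo[a] : u - d < u by rewrite ltrBlDr ltrDl.
have /rat_in_itvoo[c] : u < u + d by rewrite ltrDl.
rewrite !in_itv /= => /andP[uc cd] /andP[da au].
set T : RY R := if b then 'X%:F else 'X%:F^-1.
have sT := subfield_setT (RY R).
have zc (z' : RY R -> option RR) (x : rat) : Rplace z' -> z' (cst R (ratr x)) = Some (ratr x).
  by move=> Pz'; rewrite (Rplace_cst emb _ Pz') fmorph_rat.
have zT : z T = Some u by rewrite -zF_chart.
exists [:: T - cst R (ratr a); cst R (ratr c) - T]; split=> [h|z' Pz' H].
  rewrite !inE => /orP[]/eqP ->.
    by exists (u - ratr a); rewrite (placeB sT Pz I I zT (zc _ _ Pz)) subr_gt0.
  by exists (ratr c - u); rewrite (placeB sT Pz I I (zc _ _ Pz) zT) subr_gt0.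
have [v [vE v0]] := H _ (mem_head _ _).
(* The condition [Hsub] includes finiteness, so [T] has a finite value at [z']. *)
have zT' : z' T = Some (v + ratr a).
  by rewrite -(subrK (cst R (ratr a)) T); apply: (placeD Pz' I I vE (zc _ _ Pz')).
have [|v' []] := H (cst R (ratr c) - T); first by rewrite !inE eqxx orbT.
rewrite (placeB sT Pz' I I (zc _ _ Pz') zT') => -[<-]; rewrite subr_gt0 => vc.
rewrite /Hsub xf gE; apply: dP (zF_marked Pz') (etrans (zF_chart b Pz') zT') _.
rewrite ltr_distl (lt_trans vc cd) andbT (lt_trans da) //.
by rewrite ltrDr.
Qed.

Lemma iota_restrX z : Rplace z -> restrX (iota z) xi.
Proof.
move=> Pz c; have [_ [xiyX _]] := xiy_gauss; have [_ [Pc _]] := zF_ext Pz.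
rewrite /iota /place_comp xiyX; case xc: (xi c) => [r|//] /=.
by apply: Pc; exists c.
Qed.

Lemma xiy_liftY (p : {poly R}) : xiy (liftY p)%:F = Some (map_poly emb p)%:F.
Proof.
have [_ [_ xiyP]] := xiy_gauss; rewrite xiyP => [|i].
  congr (Some _%:F); apply/polyP => i.
  rewrite [LHS]coef_map_id0; last exact: (reduction0 xi_place).
  rewrite [RHS]coef_map /liftY (coef_map (cst R)).
  exact: (congr1 (odflt 0) (xi_id _)).
have -> : (liftY p)`_i = cstX p`_i := coef_map (cst R) p i.
by rewrite xi_id.
Qed.

Lemma iota_restrY z : Rplace z -> restrY (iota z) z.
Proof.
move=> Pz p q q0; have [Px _] := xiy_gauss; have [_ [_ zX]] := zF_ext Pz.
have eq0 : (map_poly emb q)%:F != 0 by rewrite tofrac_eq0 map_poly_eq0.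
rewrite /iota /place_comp.
rewrite (placeM Px I I (xiy_liftY p) (placeV (subfield_setT _) Px I (xiy_liftY q) eq0)).
(* [R] embeds in [Fbar] since [xi] is [emb] on [R]. With constants restricted to [R], [zF z] and [z]
   agree on constants and on [y], hence on every fraction over [R]. *)
have mk1 : marked (fun _ => True) (FbarY xi) (cst RR \o emb) emb (zF z) 'X%:F.
  apply: (marked_sub (subfield_setT _) _ _ (zF_marked Pz)) => // c _.
  by exists (cstX c).
have := place_agree mk1 (Rplace_marked emb Pz) zX.
move=> /(_ p q (fun=> I) (fun=> I) q0).
have lift (r : {poly R}) : (map_poly (cst RR \o emb) r).['X%:F] = (map_poly emb r)%:F.
  by rewrite map_poly_comp horner_cst.
by rewrite !lift (horner_cst p) (horner_cst q).
Qed.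

Lemma iota_injective z1 z2 : Rplace z1 -> Rplace z2 ->
  (forall f, iota z1 f = iota z2 f) -> forall f, z1 f = z2 f.
Proof.
move=> P1 P2 E f; have [p [q [q0 ->]]] := frac_repr f.
by rewrite -(iota_restrY P1) // -(iota_restrY P2).
Qed.

Lemma iota_props_iota : iota_props xi iota.
Proof.
split; [exact: iota_place|exact: iota_continuous|exact: iota_injective|..].
  exact: iota_restrY.
exact: iota_restrX.
Qed.

End Existence.

Theorem theorem6p3 (RR : realType) (R : rcfType) (emb : {rmorphism R -> RR})
  (xi : RX R -> option RR)
  (xi_place : Rplace xi)
  (xi_id : forall c : R, xi (cstX c) = Some (emb c))
  (xiy : RXY R -> option (RRY RR)) (xiy_gauss : gauss_ext xi xiy)
  (zF : (RY R -> option RR) -> (RRY RR -> option RR))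
  (zF_ext : forall z, Rplace z -> const_ext xi z (zF z)) :
  let iota := fun z => place_comp (zF z) xiy in
  iota_props xi iota /\
  (forall iota', iota_props xi iota' ->
     forall z, Rplace z -> forall f, iota' z f = iota z f).
Proof.
move=> iota; have iP := iota_props_iota xi_place xi_id xiy_gauss zF_ext.
by split=> // iota' iP' z Pz f; apply: (iota_unique xi_place xi_id).
Qed.
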